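(* Let $k$ be an algebraically closed field of positive characteristic $p$. (1) If $p=2$: for all $e_2>e_1\ge0$, $\sigma_{(\mathrm{IV})^\sharp,(e_1,e_2)}$ is indecomposable; for all $e_1\ge0$, $\sigma_{(\mathrm{V})^\sharp,e_1}$ is indecomposable; for all $e_1\ge 0$, $\sigma_{(\mathrm{XI})^\sharp,e_1}=\sigma^{(3.1.\mathrm{b})}_{e_1}\oplus\sigma^{(1)}$ is an indecomposable decomposition; for all $e_2\ge e_3\ge0$, $\sigma_{(\mathrm{XV})^\sharp,(e_2,e_3)}=\sigma^{(2.1)}_{e_2}\oplus\sigma^{(2.1)}_{e_3}$ is an indecomposable decomposition; for all $e_1\ge0$, $\sigma_{(\mathrm{XIX})^\sharp,e_1}=\sigma^{(3.1.\mathrm{a})}_{e_1}\oplus\sigma^{(1)}$ is an indecomposable decomposition; for all $e_2\ge0$, $\sigma_{(\mathrm{XXIV})^\sharp,e_2}=\sigma^{(2.1)}_{e_2}\oplus\sigma^{(1)}\oplus\sigma^{(1)}$ is an indecomposable decomposition; $\sigma_{(\mathrm{XXVI})^\sharp}=\sigma^{(1)}\oplus\sigma^{(1)}\oplus\sigma^{(1)}\oplus\sigma^{(1)}$ is an indecomposable decomposition. (2) If $p=3$: for all $e_1\ge0$, $\sigma_{(\mathrm{II})^\sharp,e_1}$ is indecomposable; for all $e_2>e_1\ge0$, $\sigma_{(\mathrm{IV})^\sharp,(e_1,e_2)}$ is indecomposable; for all $e_1\ge0$, $\sigma_{(\mathrm{VII})^\sharp,e_1}$ is indecomposable; for all $e_1\ge0$,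 $\sigma_{(\mathrm{IX})^\sharp,e_1}=\sigma^{(3.2.\mathrm{a})}_{e_1}\oplus\sigma^{(1)}$ is an indecomposable decomposition; for all $e_2\ge e_3\ge0$, $\sigma_{(\mathrm{XV})^\sharp,(e_2,e_3)}=\sigma^{(2.1)}_{e_2}\oplus\sigma^{(2.1)}_{e_3}$ is an indecomposable decomposition; for all $e_2\ge0$, $\sigma_{(\mathrm{XXIV})^\sharp,e_2}=\sigma^{(2.1)}_{e_2}\oplus\sigma^{(1)}\oplus\sigma^{(1)}$ is an indecomposable decomposition; $\sigma_{(\mathrm{XXVI})^\sharp}=\sigma^{(1)}\oplus\sigma^{(1)}\oplus\sigma^{(1)}\oplus\sigma^{(1)}$ is an indecomposable decomposition. (3) If $p\ge5$: for all $e_1\ge0$, $\sigma_{(\mathrm{I})^\sharp,e_1}$ is indecomposable; for all $e_2>e_1\ge0$, $\sigma_{(\mathrm{IV})^\sharp,(e_1,e_2)}$ is indecomposable; for all $e_1\ge0$, $\sigma_{(\mathrm{IX})^\sharp,e_1}=\sigma^{(3.2.\mathrm{a})}_{e_1}\oplus\sigma^{(1)}$ is an indecomposable decomposition; for all $e_2\ge e_3\ge0$, $\sigma_{(\mathrm{XV})^\sharp,(e_2,e_3)}=\sigma^{(2.1)}_{e_2}\oplus\sigma^{(2.1)}_{e_3}$ is an indecomposable decomposition; for all $e_2\ge0$, $\sigma_{(\mathrm{XXIV})^\sharp,e_2}=\sigma^{(2.1)}_{e_2}\oplus\sigma^{(1)}\oplus\sigma^{(1)}$ is an indecomposable decomposition;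 $\sigma_{(\mathrm{XXVI})^\sharp}=\sigma^{(1)}\oplus\sigma^{(1)}\oplus\sigma^{(1)}\oplus\sigma^{(1)}$ is an indecomposable decomposition.
   Context: A homomorphism (of algebraic groups) $\sigma:\mathrm{SL}(2,k)\to\mathrm{SL}(n,k)$ is indecomposable if the $n$-dimensional column vector space over $k$, with $\mathrm{SL}(2,k)$ acting through $\sigma$, is an indecomposable $\mathrm{SL}(2,k)$-module. $\oplus$ is the block-diagonal sum, and an indecomposable decomposition is a direct sum expression in which all summands are indecomposable. All exponents $e,e_i$ are integers. Homomorphisms are given by their value at $\begin{pmatrix} a & b \\ c & d \end{pmatrix}\in\mathrm{SL}(2,k)$. Small homomorphisms ($e\ge0$, $q=p^e$): $\sigma^{(1)}=(1)$; $\sigma^{(2.1)}_e=\begin{pmatrix} a^q & b^q \\ c^q & d^q \end{pmatrix}$; for $p=2$, $$\sigma^{(3.1.\mathrm a)}_e=\begin{pmatrix} a^{pq} & b^{pq} & 0 \\ c^{pq} & d^{pq} & 0 \\ a^qc^q & b^qd^q & 1 \end{pmatrix},\qquad \sigma^{(3.1.\mathrm b)}_e=\begin{pmatrix} a^{pq} & b^{pq} & a^qb^q \\ c^{pq} & d^{pq} & c^qd^q \\ 0 & 0 & 1 \end{pmatrix};$$ for $p\ge3$, $$\sigma^{(3.2.\mathrm a)}_e=\begin{pmatrix} a^{2q} & a^qb^q & b^{2q} \\ 2a^qc^q & a^qd^q+b^qc^q & 2b^qd^q \\ c^{2q} & c^qd^q & d^{2q} \end{pmatrix}.$$ Homomorphisms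 to $\mathrm{SL}(4,k)$ (with $q=p^{e_1}$ where $e_1$ occurs): $p\ge5$: $$\sigma_{(\mathrm I)^\sharp,e_1}=\begin{pmatrix} a^{3q} & a^{2q}b^q & a^qb^{2q} & b^{3q} \\ 3a^{2q}c^q & a^q(a^qd^q+2b^qc^q) & b^q(2a^qd^q+b^qc^q) & 3b^{2q}d^q \\ 3a^qc^{2q} & c^q(2a^qd^q+b^qc^q) & d^q(a^qd^q+2b^qc^q) & 3b^qd^{2q} \\ c^{3q} & c^{2q}d^q & c^qd^{2q} & d^{3q} \end{pmatrix}.$$ $p=3$: $$\sigma_{(\mathrm{II})^\sharp,e_1}=\begin{pmatrix} a^{3q} & b^{3q} & a^{2q}b^q & \frac12a^qb^{2q} \\ c^{3q} & d^{3q} & c^{2q}d^q & \frac12c^qd^{2q} \\ 0 & 0 & a^q & b^q \\ 0 & 0 & c^q & d^q \end{pmatrix},\quad \sigma_{(\mathrm{VII})^\sharp,e_1}=\begin{pmatrix} a^q & b^q & \frac12a^{2q}c^q & \frac12b^{2q}d^q \\ c^q & d^q & a^qc^{2q} & b^qd^{2q} \\ 0 & 0 & a^{3q} & b^{3q} \\ 0 & 0 & c^{3q} & d^{3q} \end{pmatrix}.$$ Any $p$, $e_2>e_1\ge0$: $\sigma_{(\mathrm{IV})^\sharp,(e_1,e_2)}=\begin{pmatrix} a^{p^{e_2}} & b^{p^{e_2}} \\ c^{p^{e_2}} & d^{p^{e_2}} \end{pmatrix}\otimes\begin{pmatrix} a^{p^{e_1}} & b^{p^{e_1}} \\ c^{p^{e_1}}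 & d^{p^{e_1}} \end{pmatrix}$ (Kronecker product: the block matrix with blocks $a^{p^{e_2}}X,\ b^{p^{e_2}}X;\ c^{p^{e_2}}X,\ d^{p^{e_2}}X$, $X$ the second factor). $p=2$: $$\sigma_{(\mathrm V)^\sharp,e_1}=\begin{pmatrix} 1 & 0 & 0 & 0 \\ a^qb^q & a^{2q} & b^{2q} & 0 \\ c^qd^q & c^{2q} & d^{2q} & 0 \\ b^qc^q & a^qc^q & b^qd^q & 1 \end{pmatrix},\quad \sigma_{(\mathrm{XI})^\sharp,e_1}=\begin{pmatrix} a^{2q} & b^{2q} & a^qb^q & 0 \\ c^{2q} & d^{2q} & c^qd^q & 0 \\ 0 & 0 & 1 & 0 \\ 0 & 0 & 0 & 1 \end{pmatrix},\quad \sigma_{(\mathrm{XIX})^\sharp,e_1}=\begin{pmatrix} a^{2q} & b^{2q} & 0 & 0 \\ c^{2q} & d^{2q} & 0 & 0 \\ a^qc^q & b^qd^q & 1 & 0 \\ 0 & 0 & 0 & 1 \end{pmatrix}.$$ $p\ge3$: $$\sigma_{(\mathrm{IX})^\sharp,e_1}=\begin{pmatrix} a^{2q} & a^qb^q & b^{2q} & 0 \\ 2a^qc^q & a^qd^q+b^qc^q & 2b^qd^q & 0 \\ c^{2q} & c^qd^q & d^{2q} & 0 \\ 0 & 0 & 0 & 1 \end{pmatrix}.$$ Any $p$, $e_2\ge e_3\ge0$: $\sigma_{(\mathrm{XV})^\sharp,(e_2,e_3)}$ is the block-diagonal matrix with blocks $\begin{pmatrix} a^{p^{e_2}} & b^{p^{e_2}}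 \\ c^{p^{e_2}} & d^{p^{e_2}} \end{pmatrix}$ and $\begin{pmatrix} a^{p^{e_3}} & b^{p^{e_3}} \\ c^{p^{e_3}} & d^{p^{e_3}} \end{pmatrix}$; $\sigma_{(\mathrm{XXIV})^\sharp,e_2}$ ($e_2\ge0$) is the block-diagonal matrix with blocks $\begin{pmatrix} a^{p^{e_2}} & b^{p^{e_2}} \\ c^{p^{e_2}} & d^{p^{e_2}} \end{pmatrix}$, $1$, $1$; $\sigma_{(\mathrm{XXVI})^\sharp}=I_4$ constantly. *)

(* Defs.v *)
From mathcomp Require Import all_boot all_algebra.
From mathcomp Require Import mpoly mxtens.

Set Implicit Arguments.
Unset Strict Implicit.
Unset Printing Implicit Defensive.

Import GRing.Theory.

Local Open Scope ring_scope.

Definition SL (k : fieldType) (n : nat) : {pred 'M[k]_n} :=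
  [pred g : 'M[k]_n | \det g == 1].
Arguments SL : clear implicits.

(* Maps SL(2,k) -> SL(n,k) are represented by functions on all 2 x 2 matrices,
   of which only the values on SL(2,k) matter. *)

(* The coordinate ring of SL(2,k) is a quotient of the polynomial ring in the
   four matrix entries, so a map to matrices is a morphism of varieties iff
   its entries are given by polynomials in a, b, c, d. *)
Definition regular_map (k : fieldType) (n : nat)
    (sigma : 'M[k]_2 -> 'M[k]_n) : Prop :=
  exists P : 'I_n -> 'I_n -> {mpoly k[2 * 2]},
    forall g, g \in SL k 2 ->
    forall i j, sigma g i j = (P i j).@[mxvec g 0].

Definition algebraic_hom (k : fieldType) (n : nat)
    (sigma : 'M[k]_2 -> 'M[k]_n) : Prop :=
  [/\ {in SL k 2, forall g, sigma g \in SL k n},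
      {in SL k 2 &, forall g h, sigma (g *m h) = sigma g *m sigma h}
    & regular_map sigma].

Definition submodule (k : fieldType) (n : nat)
    (sigma : 'M[k]_2 -> 'M[k]_n) (U : {vspace 'cV[k]_n}) : Prop :=
  forall g, g \in SL k 2 -> forall v, v \in U -> sigma g *m v \in U.

(* The zero module is not indecomposable, hence the condition 0 < n. *)
Definition indecomposable_module (k : fieldType) (n : nat)
    (sigma : 'M[k]_2 -> 'M[k]_n) : Prop :=
  (0 < n)%N /\
  forall U W : {vspace 'cV[k]_n}, submodule sigma U -> submodule sigma W ->
    (U + W = fullv)%VS -> (U :&: W = 0)%VS -> U = 0%VS \/ W = 0%VS.

(* Indecomposability is a notion for homomorphisms of algebraic groups. *)
Definition indecomposable (k : fieldType) (n : nat)
    (sigma : 'M[k]_2 -> 'M[k]_n) : Prop :=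
  algebraic_hom sigma /\ indecomposable_module sigma.

Definition hom_eq (k : fieldType) (n : nat)
    (sigma tau : 'M[k]_2 -> 'M[k]_n) : Prop :=
  {in SL k 2, sigma =1 tau}.

Definition hom_dsum (k : fieldType) (m n : nat)
    (sigma : 'M[k]_2 -> 'M[k]_m) (tau : 'M[k]_2 -> 'M[k]_n)
    (g : 'M[k]_2) : 'M[k]_(m + n) :=
  block_mx (sigma g) 0 0 (tau g).

Declare Scope hom_scope.
Delimit Scope hom_scope with hom.
Notation "sigma ⊕ tau" := (hom_dsum sigma tau)
  (at level 50, left associativity) : hom_scope.
Notation "sigma ≡ tau" := (hom_eq sigma tau)
  (at level 70, no associativity) : hom_scope.

Definition mx_of_rows (k : fieldType) (n : nat) (rows : seq (seq k)) :
    'M[k]_n :=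
  \matrix_(i, j) (nth [::] rows i)`_j.

Section Homomorphisms.

Variables (k : fieldType) (p : nat).
Implicit Types (e : nat) (g : 'M[k]_2).

Definition sigma1 g : 'M[k]_1 := mx_of_rows 1 [:: [:: 1]].

Definition sigma21 e g : 'M[k]_2 :=
  let q := (p ^ e)%N in
  let a := g 0 0 in let b := g 0 1 in let c := g 1 0 in let d := g 1 1 in
  mx_of_rows 2
    [:: [:: a ^+ q; b ^+ q];
        [:: c ^+ q; d ^+ q]].

Definition sigma31a e g : 'M[k]_3 :=
  let q := (p ^ e)%N in
  let a := g 0 0 in let b := g 0 1 in let c := g 1 0 in let d := g 1 1 in
  mx_of_rows 3
    [:: [:: a ^+ (p * q);    b ^+ (p * q);    0];
        [:: c ^+ (p * q);    d ^+ (p * q);    0];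
        [:: a ^+ q * c ^+ q; b ^+ q * d ^+ q; 1]].

Definition sigma31b e g : 'M[k]_3 :=
  let q := (p ^ e)%N in
  let a := g 0 0 in let b := g 0 1 in let c := g 1 0 in let d := g 1 1 in
  mx_of_rows 3
    [:: [:: a ^+ (p * q); b ^+ (p * q); a ^+ q * b ^+ q];
        [:: c ^+ (p * q); d ^+ (p * q); c ^+ q * d ^+ q];
        [:: 0;            0;            1]].

Definition sigma32a e g : 'M[k]_3 :=
  let q := (p ^ e)%N in
  let a := g 0 0 in let b := g 0 1 in let c := g 1 0 in let d := g 1 1 in
  mx_of_rows 3
    [:: [:: a ^+ (2 * q);          a ^+ q * b ^+ q;                   b ^+ (2 * q)];
        [:: 2 * a ^+ q * c ^+ q;   a ^+ q * d ^+ q + b ^+ q * c ^+ q; 2 * b ^+ q * d ^+ q];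
        [:: c ^+ (2 * q);          c ^+ q * d ^+ q;                   d ^+ (2 * q)]].

Definition sigmaI e1 g : 'M[k]_4 :=
  let q := (p ^ e1)%N in
  let a := g 0 0 in let b := g 0 1 in let c := g 1 0 in let d := g 1 1 in
  mx_of_rows 4
    [:: [:: a ^+ (3 * q);
            a ^+ (2 * q) * b ^+ q;
            a ^+ q * b ^+ (2 * q);
            b ^+ (3 * q)];
        [:: 3 * a ^+ (2 * q) * c ^+ q;
            a ^+ q * (a ^+ q * d ^+ q + 2 * b ^+ q * c ^+ q);
            b ^+ q * (2 * a ^+ q * d ^+ q + b ^+ q * c ^+ q);
            3 * b ^+ (2 * q) * d ^+ q];
        [:: 3 * a ^+ q * c ^+ (2 * q);
            c ^+ q * (2 * a ^+ q * d ^+ q + b ^+ q * c ^+ q);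
            d ^+ q * (a ^+ q * d ^+ q + 2 * b ^+ q * c ^+ q);
            3 * b ^+ q * d ^+ (2 * q)];
        [:: c ^+ (3 * q);
            c ^+ (2 * q) * d ^+ q;
            c ^+ q * d ^+ (2 * q);
            d ^+ (3 * q)]].

Definition sigmaII e1 g : 'M[k]_4 :=
  let q := (p ^ e1)%N in
  let a := g 0 0 in let b := g 0 1 in let c := g 1 0 in let d := g 1 1 in
  mx_of_rows 4
    [:: [:: a ^+ (3 * q); b ^+ (3 * q); a ^+ (2 * q) * b ^+ q; 2^-1 * a ^+ q * b ^+ (2 * q)];
        [:: c ^+ (3 * q); d ^+ (3 * q); c ^+ (2 * q) * d ^+ q; 2^-1 * c ^+ q * d ^+ (2 * q)];
        [:: 0;            0;            a ^+ q;                b ^+ q];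
        [:: 0;            0;            c ^+ q;                d ^+ q]].

Definition sigmaIV e1 e2 g : 'M[k]_4 := tensmx (sigma21 e2 g) (sigma21 e1 g).

Definition sigmaV e1 g : 'M[k]_4 :=
  let q := (p ^ e1)%N in
  let a := g 0 0 in let b := g 0 1 in let c := g 1 0 in let d := g 1 1 in
  mx_of_rows 4
    [:: [:: 1;               0;               0;               0];
        [:: a ^+ q * b ^+ q; a ^+ (2 * q);    b ^+ (2 * q);    0];
        [:: c ^+ q * d ^+ q; c ^+ (2 * q);    d ^+ (2 * q);    0];
        [:: b ^+ q * c ^+ q; a ^+ q * c ^+ q; b ^+ q * d ^+ q; 1]].

Definition sigmaVII e1 g : 'M[k]_4 :=
  let q := (p ^ e1)%N in
  let a := g 0 0 in let b := g 0 1 in let c := g 1 0 in let d := g 1 1 in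
  mx_of_rows 4
    [:: [:: a ^+ q; b ^+ q; 2^-1 * a ^+ (2 * q) * c ^+ q; 2^-1 * b ^+ (2 * q) * d ^+ q];
        [:: c ^+ q; d ^+ q; a ^+ q * c ^+ (2 * q);        b ^+ q * d ^+ (2 * q)];
        [:: 0;      0;      a ^+ (3 * q);                 b ^+ (3 * q)];
        [:: 0;      0;      c ^+ (3 * q);                 d ^+ (3 * q)]].

Definition sigmaIX e1 g : 'M[k]_4 :=
  let q := (p ^ e1)%N in
  let a := g 0 0 in let b := g 0 1 in let c := g 1 0 in let d := g 1 1 in
  mx_of_rows 4
    [:: [:: a ^+ (2 * q);        a ^+ q * b ^+ q;                   b ^+ (2 * q);        0];
        [:: 2 * a ^+ q * c ^+ q; a ^+ q * d ^+ q + b ^+ q * c ^+ q; 2 * b ^+ q * d ^+ q; 0];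
        [:: c ^+ (2 * q);        c ^+ q * d ^+ q;                   d ^+ (2 * q);        0];
        [:: 0;                   0;                                 0;                   1]].

Definition sigmaXI e1 g : 'M[k]_4 :=
  let q := (p ^ e1)%N in
  let a := g 0 0 in let b := g 0 1 in let c := g 1 0 in let d := g 1 1 in
  mx_of_rows 4
    [:: [:: a ^+ (2 * q); b ^+ (2 * q); a ^+ q * b ^+ q; 0];
        [:: c ^+ (2 * q); d ^+ (2 * q); c ^+ q * d ^+ q; 0];
        [:: 0;            0;            1;               0];
        [:: 0;            0;            0;               1]].

Definition sigmaXV e2 e3 g : 'M[k]_4 :=
  let q2 := (p ^ e2)%N in let q3 := (p ^ e3)%N in
  let a := g 0 0 in let b := g 0 1 in let c := g 1 0 in let d := g 1 1 in
  mx_of_rows 4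
    [:: [:: a ^+ q2; b ^+ q2; 0;       0];
        [:: c ^+ q2; d ^+ q2; 0;       0];
        [:: 0;       0;       a ^+ q3; b ^+ q3];
        [:: 0;       0;       c ^+ q3; d ^+ q3]].

Definition sigmaXIX e1 g : 'M[k]_4 :=
  let q := (p ^ e1)%N in
  let a := g 0 0 in let b := g 0 1 in let c := g 1 0 in let d := g 1 1 in
  mx_of_rows 4
    [:: [:: a ^+ (2 * q);    b ^+ (2 * q);    0; 0];
        [:: c ^+ (2 * q);    d ^+ (2 * q);    0; 0];
        [:: a ^+ q * c ^+ q; b ^+ q * d ^+ q; 1; 0];
        [:: 0;               0;               0; 1]].

Definition sigmaXXIV e2 g : 'M[k]_4 :=
  let q2 := (p ^ e2)%N in
  let a := g 0 0 in let b := g 0 1 in let c := g 1 0 in let d := g 1 1 in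
  mx_of_rows 4
    [:: [:: a ^+ q2; b ^+ q2; 0; 0];
        [:: c ^+ q2; d ^+ q2; 0; 0];
        [:: 0;       0;       1; 0];
        [:: 0;       0;       0; 1]].

Definition sigmaXXVI g : 'M[k]_4 := 1%:M.

End Homomorphisms.

Arguments sigma1 : clear implicits.
Arguments sigma21 : clear implicits.
Arguments sigma31a : clear implicits.
Arguments sigma31b : clear implicits.
Arguments sigma32a : clear implicits.
Arguments sigmaI : clear implicits.
Arguments sigmaII : clear implicits.
Arguments sigmaIV : clear implicits.
Arguments sigmaV : clear implicits.
Arguments sigmaVII : clear implicits.
Arguments sigmaIX : clear implicits.
Arguments sigmaXI : clear implicits.
Arguments sigmaXV : clear implicits.
Arguments sigmaXIX : clear implicits.
Arguments sigmaXXIV : clear implicits.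
Arguments sigmaXXVI : clear implicits.

(* Main.v *)
(** Let E be the projection onto one summand of a decomposition into two
    submodules: an idempotent matrix commuting with every sigma(g). Since k is
    infinite, commutation with diag(t, t^-1) kills the entries of E between
    distinct weights, and commutation with the unipotent [[1, 1], [0, 1]] then
    makes E a scalar, so E = 0 or E = 1. Only sigma_V has a repeated weight (0,
    twice); there the unipotent leaves E = alpha + gamma e_{41}, and E^2 = E
    forces gamma = 0. The Frobenius is bijective on SL(2,k), which
    reduces all exponents to e = 0 (e1 = 0 for sigma_IV). *)

Require Import Defs.
From mathcomp Require Import all_boot all_algebra.
From mathcomp Require Import mpoly mxtens ring zify.

Set Implicit Arguments.
Unset Strict Implicit.
Unset Printing Implicit Defensive.

Import GRing.Theory.

Local Open Scope ring_scope.
Local Open Scope hom_scope.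

(** * Polynomial functions of the matrix entries *)

Section Regular.

Variable k : fieldType.

(** The equation is asked of every 2 x 2 matrix, so that the closure lemmas carry no determinant
    condition. *)
Definition regular_fun (f : 'M[k]_2 -> k) : Prop :=
  exists P : {mpoly k[2 * 2]}, forall g, f g = P.@[mxvec g 0].

Lemma regular_const c : regular_fun (fun=> c).
Proof. by exists c%:MP => g; rewrite mevalC. Qed.

Lemma regular_entry i j : regular_fun (fun g => g i j).
Proof. by exists 'X_(mxvec_index i j) => g; rewrite mevalXU mxvecE. Qed.

Lemma regularD f h :
  regular_fun f -> regular_fun h -> regular_fun (fun g => f g + h g).
Proof. by move=> [P fP] [Q hQ]; exists (P + Q) => g; rewrite mevalD fP hQ. Qed.

Lemma regularM f h :
  regular_fun f -> regular_fun h -> regular_fun (fun g => f g * h g).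
Proof. by move=> [P fP] [Q hQ]; exists (P * Q) => g; rewrite mevalM fP hQ. Qed.

Lemma regularX f n : regular_fun f -> regular_fun (fun g => f g ^+ n).
Proof. by move=> [P fP]; exists (P ^+ n) => g; rewrite rmorphXn /= fP. Qed.

Lemma regular_map_entries n (sigma : 'M[k]_2 -> 'M[k]_n) :
  (forall i j, regular_fun (fun g => sigma g i j)) -> regular_map sigma.
Proof.
move=> reg.
have /fin_all_exists[P sigmaP] (ij : 'I_n * 'I_n) :
    exists Q : {mpoly k[2 * 2]}, forall g, sigma g ij.1 ij.2 = Q.@[mxvec g 0].
  exact: reg.
by exists (fun i j => P (i, j)) => g _ i j; exact: (sigmaP (i, j)).
Qed.

Lemma regular_mx_of_rows n (rows : 'M[k]_2 -> seq (seq k)) :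
  (forall i j, (i < n)%N -> (j < n)%N ->
     regular_fun (fun g => (nth [::] (rows g) i)`_j)) ->
  regular_map (fun g => mx_of_rows n (rows g)).
Proof.
move=> reg; apply: regular_map_entries => i j.
have [P rowsP] := reg i j (ltn_ord i) (ltn_ord j).
by exists P => g; rewrite mxE.
Qed.

End Regular.

(** * Determinants and distinguished elements in small sizes *)

Section SmallMatrices.

Variable k : fieldType.
Implicit Types g h : 'M[k]_2.

Lemma mulmx2E g h i j : (g *m h) i j = g i 0 * h 0 j + g i 1 * h 1 j.
Proof.
rewrite !mxE !big_ord_recl big_ord0 addr0.
by congr (_ + g i _ * h _ j); apply: val_inj.
Qed.

(** Indexing by [nat] instead of ordinals lets the minors in a cofactor expansion, shifted by
    [bump], compute by simplification. *)
Definition fun_mx n (F : nat -> nat -> k) : 'M[k]_n := \matrix_(i, j) F i j.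

Lemma det_fun_mx n F :
  \det (fun_mx n.+1 F) =
  \sum_(j < n.+1) (-1) ^+ j * F 0%N j *
     \det (fun_mx n (fun i l => F i.+1 (bump j l))).
Proof.
rewrite (expand_det_row _ ord0); apply: eq_bigr => j _.
rewrite mxE /cofactor add0n mulrCA mulrA; congr (_ * \det _).
by apply/matrixP=> i l; rewrite !mxE.
Qed.

Lemma det_fun_mx2 F :
  \det (fun_mx 2 F) = F 0%N 0%N * F 1%N 1%N - F 0%N 1%N * F 1%N 0%N.
Proof.
rewrite det_fun_mx !big_ord_recl big_ord0.
by rewrite !det_fun_mx !big_ord_recl !big_ord0 !det_mx00 /bump /=; ring.
Qed.

Lemma det_fun_mx3 F :
  \det (fun_mx 3 F) =
    F 0%N 0%N * (F 1%N 1%N * F 2%N 2%N - F 1%N 2%N * F 2%N 1%N) -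
    F 0%N 1%N * (F 1%N 0%N * F 2%N 2%N - F 1%N 2%N * F 2%N 0%N) +
    F 0%N 2%N * (F 1%N 0%N * F 2%N 1%N - F 1%N 1%N * F 2%N 0%N).
Proof.
rewrite det_fun_mx !big_ord_recl big_ord0.
by rewrite !det_fun_mx2 /bump /=; ring.
Qed.

Lemma det_fun_mx4 F :
  \det (fun_mx 4 F) =
    F 0%N 0%N * \det (fun_mx 3 (fun i j => F i.+1 j.+1)) -
    F 0%N 1%N * \det (fun_mx 3 (fun i j => F i.+1 (bump 1 j))) +
    F 0%N 2%N * \det (fun_mx 3 (fun i j => F i.+1 (bump 2 j))) -
    F 0%N 3%N * \det (fun_mx 3 (fun i j => F i.+1 (bump 3 j))).
Proof.
rewrite det_fun_mx !big_ord_recl big_ord0.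
by rewrite !det_fun_mx3 /bump /=; ring.
Qed.

Lemma det_mx_of_rows n rows :
  \det (mx_of_rows n rows : 'M[k]_n) =
  \det (fun_mx n (fun i j => (nth [::] rows i)`_j)).
Proof. by congr (\det _); apply/matrixP=> i j; rewrite !mxE. Qed.

Lemma det_mx2 g : \det g = g 0 0 * g 1 1 - g 0 1 * g 1 0.
Proof.
have -> : g = fun_mx 2 (fun i j => g (inord i) (inord j)).
  by apply/matrixP=> i j; rewrite !mxE !inord_val.
by rewrite det_fun_mx2 !mxE.
Qed.

(** The single monomial on the left is the shape in which [ring] accepts an equation as a rewriting
    rule. *)
Lemma SL2P g : reflect (g 0 0 * g 1 1 = 1 + g 0 1 * g 1 0) (g \in SL k 2).
Proof. by rewrite inE det_mx2 subr_eq; apply: eqP. Qed.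

Definition torus (t : k) : 'M[k]_2 := mx_of_rows 2 [:: [:: t; 0]; [:: 0; t^-1]].

Definition transvection : 'M[k]_2 := mx_of_rows 2 [:: [:: 1; 1]; [:: 0; 1]].

Lemma torus_SL t : t != 0 -> torus t \in SL k 2.
Proof. by move=> t0; apply/SL2P; rewrite !mxE /= divff // mul0r addr0. Qed.

Lemma transvection_SL : transvection \in SL k 2.
Proof. by apply/SL2P; rewrite !mxE /= mulr1 mulr0 addr0. Qed.

Lemma tens_mx2E (A B : 'M[k]_2) :
  tensmx A B = mx_of_rows 4
    [:: [:: A 0 0 * B 0 0; A 0 0 * B 0 1; A 0 1 * B 0 0; A 0 1 * B 0 1];
        [:: A 0 0 * B 1 0; A 0 0 * B 1 1; A 0 1 * B 1 0; A 0 1 * B 1 1];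
        [:: A 1 0 * B 0 0; A 1 0 * B 0 1; A 1 1 * B 0 0; A 1 1 * B 0 1];
        [:: A 1 0 * B 1 0; A 1 0 * B 1 1; A 1 1 * B 1 0; A 1 1 * B 1 1]].
Proof.
apply/matrixP=> i j; rewrite !mxE.
by case: i => [[|[|[|[|//]]]] ?]; case: j => [[|[|[|[|//]]]] ?];
  rewrite /=; congr (A _ _ * B _ _); apply: val_inj.
Qed.

End SmallMatrices.

Arguments transvection {k}.

(** * Frobenius twists *)

Section Frobenius.

Variables (k : closedFieldType) (p : nat) (hp : p \in [pchar k]).
Implicit Types (e : nat) (g h : 'M[k]_2).

Definition frobenius_mx e g : 'M[k]_2 := map_mx (fun x => x ^+ (p ^ e)) g.

Lemma expfD_pchar e (x y : k) :
  (x + y) ^+ (p ^ e) = x ^+ (p ^ e) + y ^+ (p ^ e).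
Proof.
apply: exprDn_pchar; rewrite pnatX ?pnatE ?(pcharf_prime hp) ?hp //.
Qed.

Lemma pexp_gt0 e : (0 < p ^ e)%N.
Proof. by rewrite expn_gt0 prime_gt0 // (pcharf_prime hp). Qed.

Lemma expf_pchar_inj e : injective (fun x : k => x ^+ (p ^ e)).
Proof.
move=> x y /= exy; apply/eqP; rewrite -subr_eq0.
have: (x - y) ^+ (p ^ e) == 0.
  have := expfD_pchar e (x - y) y; rewrite subrK exy => /eqP.
  by rewrite -subr_eq subrr eq_sym.
by rewrite expf_eq0 pexp_gt0.
Qed.

Lemma expf_pchar_surj e (y : k) : exists x : k, x ^+ (p ^ e) = y.
Proof.
have /closed_rootP[x] : size ('X^(p ^ e) - y%:P) != 1%N.
  by rewrite size_XnsubC ?pexp_gt0 // eqSS -lt0n pexp_gt0.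
by rewrite rootE !hornerE subr_eq0 => /eqP; exists x.
Qed.

Lemma frobenius_mxM e g h :
  frobenius_mx e (g *m h) = frobenius_mx e g *m frobenius_mx e h.
Proof.
by apply/matrixP=> i j; rewrite mxE !mulmx2E expfD_pchar !exprMn !mxE.
Qed.

(** The right to left direction raises the determinant equation to the power p^e, which is additive;
    the converse undoes this by injectivity of that power map. *)
Lemma frobenius_SL e g : (frobenius_mx e g \in SL k 2) = (g \in SL k 2).
Proof.
apply/SL2P/SL2P; rewrite !mxE -!exprMn.
  by rewrite -[X in X + _](expr1n _ (p ^ e)) -expfD_pchar;
    apply: expf_pchar_inj.
by move->; rewrite expfD_pchar expr1n.
Qed.

Lemma frobenius_surj e h : exists g, frobenius_mx e g = h.
Proof.
have /fin_all_exists[P hP] (ij : 'I_2 * 'I_2) :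
    exists x : k, x ^+ (p ^ e) = h ij.1 ij.2.
  exact: expf_pchar_surj.
exists (\matrix_(i, j) P (i, j)).
by apply/matrixP=> i j; rewrite !mxE hP.
Qed.

(** The twisted polynomials arise by substituting ['X_l ^+ (p ^ e)] for each variable. *)
Lemma regular_map_frobenius n (sigma : 'M[k]_2 -> 'M[k]_n) e :
  regular_map sigma -> regular_map (fun g => sigma (frobenius_mx e g)).
Proof.
move=> [P sigmaP].
exists (fun i j => P i j \mPo [tuple 'X_l ^+ (p ^ e) | l < 2 * 2]) => g gSL i j.
rewrite sigmaP ?frobenius_SL // comp_mpoly_meval.
apply: meval_eq => l; rewrite tnth_mktuple rmorphXn /= mevalXU.
by case/mxvec_indexP: l => i' j'; rewrite !mxvecE mxE.
Qed.

(** Every element of SL(2,k) is a Frobenius image of another one, so [sigma] and [tau] have the same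
    image on SL(2,k) and hence the same submodules. *)
Lemma indecomposable_frobenius n (sigma tau : 'M[k]_2 -> 'M[k]_n) e :
  (forall g, tau g = sigma (frobenius_mx e g)) ->
  indecomposable sigma -> indecomposable tau.
Proof.
move=> tauE [[det_s mul_s [P sigmaP]] [n0 indec]]; split.
  split.
  - by move=> g gSL; rewrite tauE det_s // frobenius_SL.
  - by move=> g h gSL hSL; rewrite !tauE frobenius_mxM mul_s // frobenius_SL.
  - have [Q sQ] : regular_map (fun g => sigma (frobenius_mx e g)).
      by apply: regular_map_frobenius; exists P.
    by exists Q => g gSL i j; rewrite tauE sQ.
split=> // U W sU sW; apply: indec => h hSL v;
  have [g gh] := frobenius_surj e h; rewrite -gh -tauE.
- by apply: sU; rewrite -(frobenius_SL e) gh.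
- by apply: sW; rewrite -(frobenius_SL e) gh.
Qed.

End Frobenius.

(** * Indecomposability through idempotents and weights *)

Section Idempotents.

(** The projection [f] onto [U] along [W] is idempotent, and it commutes with the action because
    both [U] and [W] are stable. If its matrix is 0 then [U] vanishes, and if it is 1 then [W]
    vanishes. *)
Lemma indecomposable_module_idempotent (k : fieldType) n
    (sigma : 'M[k]_2 -> 'M[k]_n) :
  (0 < n)%N ->
  (forall E : 'M[k]_n, E *m E = E ->
     {in SL k 2, forall g, sigma g *m E = E *m sigma g} ->
     E = 0 \/ E = 1%:M) ->
  indecomposable_module sigma.
Proof.
move=> n0 idem; split=> // U W sU sW UW1 UW0.
have WU0 : (W :&: U = 0)%VS by rewrite capvC.
pose f := daddv_pi U W.
have fU v : v \in U -> f v = v by move=> vU; apply: daddv_pi_id.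
have fW v : v \in W -> f v = 0.
  move=> vW; have := daddv_pi_add (w := v) UW0; rewrite UW1 memvf => /(_ isT).
  by rewrite (daddv_pi_id WU0 vW) => /(canRL (addrK _)); rewrite subrr.
have UWE v : exists2 u, u \in U & exists2 w, w \in W & v = u + w.
  by apply/memv_addP; rewrite UW1 memvf.
have fD x y : f (x + y) = f x + f y by exact: linearD.
pose E : 'M[k]_n := \matrix_(i, j) f (delta_mx j 0) i 0.
have fE v : f v = E *m v.
  rewrite {1}[v]matrix_sum_delta linear_sum; apply/matrixP=> i j.
  rewrite summxE !mxE; apply: eq_bigr => l _.
  by rewrite big_ord1 linearZ /= !mxE !ord1 mulrC.
have mxext (A B : 'M[k]_n) : (forall v : 'cV_n, A *m v = B *m v) -> A = B.
  move=> AB; apply/matrixP=> i j; have /colP/(_ i) := AB (delta_mx j 0).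
  by rewrite -!colE !mxE.
have [|g gSL|E0|E1] := idem E.
- by apply: mxext => v; rewrite -mulmxA -!fE fU ?memv_pi.
- apply: mxext => v; rewrite -!mulmxA -!fE.
  have [u uU [w wW ->]] := UWE v.
  have -> : sigma g *m (u + w) = sigma g *m u + sigma g *m w by exact: mulmxDr.
  rewrite !fD (fU u uU) (fW w wW) (fU _ (sU g gSL u uU)).
  rewrite (fW _ (sW g gSL w wW)). by rewrite !addr0.
- left; apply/eqP; rewrite -subv0; apply/subvP=> v vU.
  by rewrite -(fU v vU) fE E0 mul0mx mem0v.
- right; apply/eqP; rewrite -subv0; apply/subvP=> v vW.
  by have := fW v vW; rewrite fE E1 mul1mx => ->; rewrite mem0v.
Qed.

Variables (k : closedFieldType).

Lemma exists_expf_neq (a b : nat) :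
  a <> b -> exists2 t : k, t != 0 & t ^+ a != t ^+ b.
Proof.
(* The factor ['X] makes the non-root nonzero. *)
move=> ab; have /closed_nonrootP[t] : 'X * ('X^a - 'X^b) != 0 :> {poly k}.
  rewrite mulf_neq0 ?polyX_eq0 // subr_eq0.
  by apply/eqP=> /(congr1 (fun q : {poly k} => size q));
    rewrite !size_polyXn => -[].
rewrite rootM !rootE !hornerE negb_or => /andP[t0]; rewrite subr_eq0.
by exists t.
Qed.

Section Weights.

(* The pair [w i = (m, l)] stands for the weight [m - l]. *)
Variables (n : nat) (sigma : 'M[k]_2 -> 'M[k]_n) (w : 'I_n -> nat * nat).

Definition torus_weights :=
  forall t, t != 0 ->
  sigma (torus t) = diag_mx (\row_i (t ^+ (w i).1 * t^-1 ^+ (w i).2)).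

(** Entry (i, j) of the commutation relation at [torus t] multiplies E_ij by t to the weight of i on
    one side and of j on the other; some t separates distinct weights. Cross-multiplying keeps all
    exponents natural. *)
Lemma commute_weights (E : 'M[k]_n) i j :
  torus_weights -> {in SL k 2, forall g, sigma g *m E = E *m sigma g} ->
  ((w i).1 + (w j).2 <> (w j).1 + (w i).2)%N -> E i j = 0.
Proof.
move=> sw comm /exists_expf_neq[t t0].
have := comm _ (torus_SL t0); rewrite sw // => /matrixP/(_ i j).
rewrite mul_diag_mx mul_mx_diag !mxE => ewE.
rewrite -subr_eq0 => dneq; apply/eqP; move: dneq; apply: contraNT => Eij.
rewrite subr_eq0 !exprD.
have {}ewE : t ^+ (w i).1 * t^-1 ^+ (w i).2 = t ^+ (w j).1 * t^-1 ^+ (w j).2.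
  by apply: (mulIf Eij); rewrite ewE mulrC.
have {}t0 m : t ^+ m != 0 by rewrite expf_neq0.
move: ewE; rewrite !exprVn => /eqP; rewrite eqr_div //.
Qed.

(** Distinct weights make [E] diagonal. A nonzero entry (j, l) of the image of [transvection] gives
    E_jj = E_ll, and such entries join [h] to every index, so [E] is a scalar; an idempotent scalar
    is 0 or 1. *)
Lemma indecomposable_module_weights (h : 'I_n) :
  torus_weights ->
  (forall i j, ((w i).1 + (w j).2 = (w j).1 + (w i).2)%N -> i = j) ->
  (forall i, (sigma transvection h i != 0) || (sigma transvection i h != 0)) ->
  indecomposable_module sigma.
Proof.
move=> sw winj hub; apply: indecomposable_module_idempotent => [|E EE comm].
  by case: h hub => i /= lt_in _; apply: leq_ltn_trans lt_in.
have Ediag : E = diag_mx (\row_i E i i).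
  apply/matrixP=> i j; rewrite !mxE; case: eqVneq => [<- //|/eqP ij].
  by rewrite mulr0n; apply: commute_weights => // /winj.
have Econst i : E i i = E h h.
  have := comm _ (transvection_SL k); rewrite [in X in X -> _]Ediag => sE.
  have {}sE j l : sigma transvection j l != 0 -> E j j = E l l.
    move=> sjl; have /matrixP/(_ j l) := sE.
    by rewrite mul_diag_mx mul_mx_diag !mxE mulrC => /(mulIf sjl).
  by case/orP: (hub i) => /sE.
have Escal : E = (E h h)%:M.
  by rewrite Ediag; apply/matrixP=> i j; rewrite !mxE eqxx mulr1n (Econst i).
move: EE; rewrite Escal -scalar_mxM; set c := E h h.
move=> /matrixP/(_ h h); rewrite !mxE eqxx !mulr1n => /eqP.
rewrite -subr_eq0 -{3}[c]mulr1 -mulrBr mulf_eq0 subr_eq0.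
by case/orP=> /eqP ->; [left; exact: raddf0 | right].
Qed.

End Weights.

End Idempotents.

(** * Entrywise verification of explicit matrices *)

Ltac case_ordinal i :=
  case: i => -[|[|[|[|?]]]] //= ?.

(** The product [g *m h] becomes a variable known only through its entries, which leaves polynomial
    identities in eight variables modulo two determinant equations. *)
Ltac check_mul gSL hSL :=
  let g := fresh "g" in let h := fresh "h" in
  let i := fresh "i" in let j := fresh "j" in
  move=> g h /SL2P gSL /SL2P hSL;
  let gh := fresh "gh" in let ghE := fresh "ghE" in
  have := mulmx2E g h; move: (g *m h) => gh ghE;
  apply/matrixP=> i j; rewrite [RHS]mxE !big_ord_recl big_ord0 !mxE !ghE;
  move: (g 0 0) (g 0 1) (g 1 0) (g 1 1) (h 0 0) (h 0 1) (h 1 0) (h 1 1) gSL hSL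
    => a b c d a' b' c' d' gSL hSL;
  case_ordinal i; case_ordinal j; rewrite ?expn0 ?muln1 /=.

Ltac check_det gSL :=
  let g := fresh "g" in
  move=> g /SL2P gSL; rewrite inE det_mx_of_rows;
  rewrite ?det_fun_mx4 ?det_fun_mx3 ?det_fun_mx2 /bump /= ?expn0 ?muln1;
  move: (g 0 0) (g 0 1) (g 1 0) (g 1 1) gSL => a b c d gSL; apply/eqP.

Ltac check_regular :=
  apply: regular_mx_of_rows => -[|[|[|[|?]]]] [|[|[|[|?]]]] //= _ _;
  repeat first [ apply: regular_const | apply: regular_entry
    | apply: regularD | apply: regularM | apply: regularX ].

(** Abstracting [t^-1] to [s] turns the claim into polynomial identities modulo t s = 1. *)
Ltac check_weights :=
  let i := fresh "i" in let j := fresh "j" in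
  let t0 := fresh "t0" in let t := fresh "t" in let ts := fresh "ts" in
  move=> t t0; apply/matrixP=> i j; rewrite !mxE;
  move: (mulfV t0); move: t^-1 => s ts;
  case_ordinal i; case_ordinal j;
  rewrite /= ?expn0 ?muln1 ?mulr1n ?mulr0n ?addn1 ?exprS ?expr0; ring: ts.

Ltac check_distinct :=
  let i := fresh "i" in let j := fresh "j" in
  let wij := fresh "wij" in
  move=> i j /= wij; apply: val_inj; move: wij; case_ordinal i; case_ordinal j.

Ltac check_hub :=
  let i := fresh "i" in
  move=> i; rewrite !mxE; case_ordinal i;
  rewrite ?expr1n ?mulr1 ?oner_eq0 /= ?orbT //.

Ltac check_frobenius :=
  let i := fresh "i" in let j := fresh "j" in
  apply/matrixP=> i j; rewrite !mxE expn0 ?muln1 ?expr1 -?exprM;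
  case_ordinal i; case_ordinal j; rewrite ?expr1 ?mulr1 // -?exprM;
  repeat first [ reflexivity | congr (_ * _) | congr (_ + _)
    | congr (_ ^+ _); lia ].

(** * Symmetric powers of the natural module *)

Section AnyCharacteristic.
Variables (k : closedFieldType) (p : nat) (hp : p \in [pchar k]).
Implicit Types e : nat.

Lemma indecomposable_sigma1 : indecomposable (sigma1 k).
Proof.
split; last first.
  by apply: (@indecomposable_module_weights _ _ _ (fun=> (0, 0)%N) ord0);
    [check_weights | move=> i j _; rewrite !ord1 | check_hub].
split.
- by move=> g _; rewrite inE det_mx11 mxE.
- move=> g h _ _; apply/matrixP=> i j.
  by rewrite !mxE big_ord1 !ord1 !mxE mulr1.
- by check_regular.
Qed.

Lemma sigma21E e g : sigma21 k p e g = frobenius_mx p e g.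
Proof.
apply/matrixP=> i j; rewrite !mxE.
by case_ordinal i; case_ordinal j; congr (g _ _ ^+ _); apply: val_inj.
Qed.

Lemma indecomposable_sigma21 e : indecomposable (sigma21 k p e).
Proof.
apply: (indecomposable_frobenius hp (sigma := sigma21 k p 0) (e := e)) => [g|].
  by check_frobenius.
split; last first.
  by apply: (@indecomposable_module_weights _ _ _
    (fun i => nth (0, 0)%N [:: (1, 0); (0, 1)]%N i) ord0);
    [check_weights | check_distinct | check_hub].
split.
- by check_det gSL; ring: gSL.
- by check_mul gSL hSL; ring: gSL hSL.
- by check_regular.
Qed.

Lemma indecomposable_sigma32a e : indecomposable (sigma32a k p e).
Proof.
apply: (indecomposable_frobenius hp (sigma := sigma32a k p 0) (e := e)) => [g|].
  by check_frobenius.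
split; last first.
  by apply: (@indecomposable_module_weights _ _ _
    (fun i => nth (0, 0)%N [:: (2, 0); (0, 0); (0, 2)]%N i) ord0);
    [check_weights | check_distinct | check_hub].
split.
- by check_det gSL; ring: gSL.
- by check_mul gSL hSL; ring: gSL hSL.
- by check_regular.
Qed.

Lemma indecomposable_sigmaI e : indecomposable (sigmaI k p e).
Proof.
apply: (indecomposable_frobenius hp (sigma := sigmaI k p 0) (e := e)) => [g|].
  by check_frobenius.
split; last first.
  by apply: (@indecomposable_module_weights _ _ _
    (* At the torus the diagonal is a^3, a(ad), d(ad), d^3 with ad = 1. The hub is 0 since row 0 of
       the transvection's image is all ones. *)
    (fun i => nth (0, 0)%N [:: (3, 0); (1, 0); (0, 1); (0, 3)]%N i) ord0);
    [check_weights | check_distinct | check_hub].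
split.
- by check_det gSL; ring: gSL.
- by check_mul gSL hSL; ring: gSL hSL.
- by check_regular.
Qed.

End AnyCharacteristic.

(** * Modules in characteristic 2 *)

Section Char2.
Variables (k : closedFieldType) (hp : 2%N \in [pchar k]).
Implicit Types e : nat.

Let char2 : 2 = 0 :> k.
Proof. exact: pcharf0 hp. Qed.

Lemma indecomposable_sigma31a e : indecomposable (sigma31a k 2 e).
Proof.
apply: (indecomposable_frobenius hp (sigma := sigma31a k 2 0) (e := e)) => [g|].
  by check_frobenius.
split; last first.
  by apply: (@indecomposable_module_weights _ _ _
    (* Here it is column 1 of the transvection's image that has no zero entry. *)
    (fun i => nth (0, 0)%N [:: (2, 0); (0, 2); (0, 0)]%N i) (@Ordinal 3 1 isT));
    [check_weights | check_distinct | check_hub].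
split.
- by check_det gSL; ring: gSL char2.
- by check_mul gSL hSL; ring: gSL hSL char2.
- by check_regular.
Qed.

Lemma indecomposable_sigma31b e : indecomposable (sigma31b k 2 e).
Proof.
apply: (indecomposable_frobenius hp (sigma := sigma31b k 2 0) (e := e)) => [g|].
  by check_frobenius.
split; last first.
  by apply: (@indecomposable_module_weights _ _ _
    (fun i => nth (0, 0)%N [:: (2, 0); (0, 2); (0, 0)]%N i) ord0);
    [check_weights | check_distinct | check_hub].
split.
- by check_det gSL; ring: gSL char2.
- by check_mul gSL hSL; ring: gSL hSL char2.
- by check_regular.
Qed.

Lemma indecomposable_sigmaV e : indecomposable (sigmaV k 2 e).
Proof.
apply: (indecomposable_frobenius hp (sigma := sigmaV k 2 0) (e := e)) => [g|].
  by check_frobenius.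
split; last first.
  apply: indecomposable_module_idempotent => // E EE comm.
  have E0 := @commute_weights _ _ _
    (fun i => nth (0, 0)%N [:: (0, 0); (2, 0); (0, 2); (0, 0)]%N i)
    E _ _ _ comm.
  (* Row i of the list holds the columns whose weight equals that of i; only the positions (0, 3)
     and (3, 0) survive off the diagonal. *)
  have {}E0 (i j : 'I_4) :
      val j \notin nth [::] [:: [:: 0; 3]; [:: 1]; [:: 2]; [:: 0; 3]]%N i ->
      E i j = 0.
    move=> nij; apply: E0; first by check_weights.
    by move: nij; case_ordinal i; case_ordinal j.
  pose o0 := @Ordinal 4 0 isT; pose o1 := @Ordinal 4 1 isT.
  pose o2 := @Ordinal 4 2 isT; pose o3 := @Ordinal 4 3 isT.
  have ordE (i : 'I_4) : [\/ i = o0, i = o1, i = o2 | i = o3].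
    by case_ordinal i;
      [constructor 1 | constructor 2 | constructor 3 | constructor 4];
      apply: val_inj.
  have mulE (A B : 'M[k]_4) i j : (A *m B) i j =
      A i o0 * B o0 j + A i o1 * B o1 j + A i o2 * B o2 j + A i o3 * B o3 j.
    rewrite mxE !big_ord_recl big_ord0 addr0 !addrA.
    by congr (_ + _ + _ + _); congr (A i _ * B _ j); apply: val_inj.
  have uE := comm _ (transvection_SL k).
  have {}uE i j := congr1 (fun M : 'M_4 => M i j) uE.
  (* The first three entries equate all diagonal coefficients of [E]; the fourth gives E_03 = 0. *)
  move: (uE o1 o0) (uE o1 o2) (uE o3 o2) (uE o0 o2).
  rewrite !mulE !mxE /= expn0 muln1.
  have E0' := (E0 o0 o1, E0 o0 o2, E0 o1 o0, E0 o1 o2, E0 o1 o3, E0 o2 o0,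
    E0 o2 o1, E0 o2 o3, E0 o3 o1, E0 o3 o2).
  rewrite !E0' // !(mulr0, mul0r, add0r, addr0, expr1n, mul1r, mulr1).
  move=> E11 E22 E33 E03; rewrite -E11 in E22; rewrite E22 in E33.
  have := congr1 (fun M : 'M_4 => M o0 o0) EE.
  have := congr1 (fun M : 'M_4 => M o3 o0) EE.
  rewrite /= !mulE !E0' // -E33 -E03 !(mulr0, mul0r, add0r, addr0).
  (* Entry (3, 0) of [E *m E] is twice E_30 E_00, which vanishes in characteristic 2, so E_30 =
     0. *)
  have -> x y : x * y + y * x = 0 :> k by ring: char2.
  move=> E30 /eqP.
  rewrite -subr_eq0 -{3}[E o0 o0]mulr1 -mulrBr mulf_eq0 subr_eq0.
  have -> : E = (E o0 o0)%:M.
    apply/matrixP=> i j; rewrite mxE.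
    by case: (ordE i) => ->; case: (ordE j) => ->;
      rewrite ?E0' // -?E11 ?E22 -?E33 -?E03 -?E30.
  rewrite mxE eqxx mulr1n.
  by case/orP=> /eqP ->; [left; exact: raddf0 | right].
split.
- by check_det gSL; ring: gSL char2.
- by check_mul gSL hSL; ring: gSL hSL char2.
- by check_regular.
Qed.
End Char2.

(* [ring: (3 = 0)] misses some multiples of 3 with negative coefficients. *)
Ltac ring_char3 hSL char3 :=
  apply: subr0_eq;
  first [ring: hSL char3 | apply: oppr_inj; ring: hSL char3].

(** * Modules in characteristic 3 *)

Section Char3.
Variables (k : closedFieldType) (hp : 3%N \in [pchar k]).
Implicit Types e : nat.

Let char3 : 3 = 0 :> k.
Proof. exact: pcharf0 hp. Qed.

Let half3 : 2^-1 = -1 :> k.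
Proof.
have -> : 2 = 3 - 1 :> k by ring.
by rewrite char3 sub0r invrN1.
Qed.

Lemma indecomposable_sigmaII e : indecomposable (sigmaII k 3 e).
Proof.
apply: (indecomposable_frobenius hp (sigma := sigmaII k 3 0) (e := e)) => [g|].
  by check_frobenius.
split; last first.
  by apply: (@indecomposable_module_weights _ _ _
    (fun i => nth (0, 0)%N [:: (3, 0); (0, 3); (1, 0); (0, 1)]%N i) ord0);
    [check_weights | check_distinct
    | check_hub; rewrite ?half3 ?oppr_eq0 ?oner_eq0].
split.
- by check_det gSL; rewrite half3; ring: char3 gSL.
(* The mixed terms collapse through the determinant of the right factor: a'd' + 2b'c' = 1 + 3b'c' =
   1. *)
- by check_mul gSL hSL; rewrite ?half3; ring_char3 hSL char3.
- by check_regular.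
Qed.

Lemma indecomposable_sigmaVII e : indecomposable (sigmaVII k 3 e).
Proof.
apply: (indecomposable_frobenius hp (sigma := sigmaVII k 3 0) (e := e)) => [g|].
  by check_frobenius.
split; last first.
  by apply: (@indecomposable_module_weights _ _ _
    (fun i => nth (0, 0)%N [:: (1, 0); (0, 1); (3, 0); (0, 3)]%N i)
    (@Ordinal 4 3 isT));
    [check_weights | check_distinct
    | check_hub; rewrite ?half3 ?oppr_eq0 ?oner_eq0 /= ?orbT].
split.
(* The two diagonal blocks are the natural module and its twist, so the determinant is (ad - bc)(a^3
   d^3 - b^3 c^3). *)
- by check_det gSL; rewrite half3; ring: char3 gSL.
- by check_mul gSL hSL; rewrite ?half3; ring_char3 gSL char3.
- by check_regular.
Qed.
End Char3.

(** * Tensor products of two twists *)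

Section Tensor.
Variables (k : closedFieldType) (p : nat) (hp : p \in [pchar k]).

Lemma indecomposable_sigmaIV e1 e2 :
  (e1 < e2)%N -> indecomposable (sigmaIV k p e1 e2).
Proof.
(* The common twist by e1 is pulled out of both factors, leaving exponents 0 and e2 - e1. *)
move=> lt_e; apply: (indecomposable_frobenius hp
  (sigma := sigmaIV k p 0 (e2 - e1)) (e := e1)) => [g|].
  have frobD d :
      frobenius_mx p (e1 + d) g = frobenius_mx p d (frobenius_mx p e1 g).
    by apply/matrixP=> i j; rewrite !mxE expnD exprM.
  by rewrite /sigmaIV !sigma21E -!frobD addn0 subnKC // ltnW.
have {lt_e} : (0 < e2 - e1)%N by rewrite subn_gt0.
move: (e2 - e1)%N => e e0.
(* With q = p^e the weights are q + 1, q - 1, 1 - q, -q - 1; they are distinct because q > 1. *)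
have q_gt1 : (1 < p ^ e)%N.
  by rewrite -{1}(exp1n e) ltn_exp2r // prime_gt1 // (pcharf_prime hp).
pose rows (g : 'M[k]_2) :=
  let a := g 0 0 in let b := g 0 1 in let c := g 1 0 in let d := g 1 1 in
  let A := a ^+ (p ^ e) in let B := b ^+ (p ^ e) in
  let C := c ^+ (p ^ e) in let D := d ^+ (p ^ e) in
  [:: [:: A * a; A * b; B * a; B * b];
      [:: A * c; A * d; B * c; B * d];
      [:: C * a; C * b; D * a; D * b];
      [:: C * c; C * d; D * c; D * d]].
have sigmaE g : sigmaIV k p 0 e g = mx_of_rows 4 (rows g).
  by rewrite /sigmaIV tens_mx2E !sigma21E !mxE !expn0 !expr1.
split; last first.
  apply: (@indecomposable_module_weights _ _ _
    (fun i => nth (0, 0)%N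
      [:: (p ^ e + 1, 0); (p ^ e, 1); (1, p ^ e); (0, p ^ e + 1)]%N i) ord0).
  (* A successor exponent lets the powers of the zero entries of the torus reduce to 0. *)
  - move=> t t0; rewrite sigmaE /rows; case: (p ^ e)%N q_gt1 => [|[|q]] // _.
    by move: t t0; check_weights.
  - check_distinct; lia.
  - move=> i; rewrite sigmaE /rows; move: i; check_hub.
split.
- move=> g gSL2; rewrite sigmaE /rows.
  (* The q-th powers become free variables tied only by AD = 1 + BC, the determinant equation of the
     Frobenius image. *)
  have := gSL2; rewrite -(frobenius_SL hp e) => /SL2P; rewrite !mxE.
  move: (g 0 0 ^+ _) (g 0 1 ^+ _) (g 1 0 ^+ _) (g 1 1 ^+ _) => A B C D ABCD.
  by move: g gSL2; check_det gSL; ring: gSL ABCD.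
- move=> g h _ _; rewrite /sigmaIV !sigma21E !(frobenius_mxM hp).
  exact: (esym (@tensmx_mul k 2 2 2 2 2 2 _ _ _ _)).
- have [P PE] : regular_map (fun g => mx_of_rows 4 (rows g)) by check_regular.
  by exists P => g /PE; rewrite sigmaE.
Qed.

End Tensor.

(** * Block-diagonal decompositions *)

Section DirectSums.
Variable k : fieldType.

(** Writing a block sum as one list of rows lets the decompositions below hold by computation. The
    shape of [r] is fixed because its lengths determine where the second block starts. *)
Lemma block_mx_of_rows m n (r s : seq (seq k)) :
  size r = m -> all (fun x => size x == m) r ->
  block_mx (mx_of_rows m r) 0 0 (mx_of_rows n s) =
  mx_of_rows (m + n)
    ([seq x ++ nseq n 0 | x <- r] ++ [seq nseq m 0 ++ x | x <- s]).
Proof.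
move=> rm /allP rrows; apply/matrixP=> i j.
rewrite [RHS]mxE nth_cat size_map rm.
rewrite -[i]splitK; case: (split i) => i' /=; rewrite ?ltn_ord.
  have i'r : (i' < size r)%N by rewrite rm.
  rewrite (nth_map [::]) // nth_cat (eqP (rrows _ (mem_nth _ i'r))).
  rewrite -[j]splitK; case: (split j) => j' /=; rewrite ?ltn_ord.
    by rewrite block_mxEul mxE.
  by rewrite block_mxEur mxE ltnNge leq_addr addKn nth_nseq if_same.
rewrite ltnNge leq_addr addKn /=.
rewrite -[j]splitK; case: (split j) => j' /=.
  rewrite block_mxEdl mxE.
  (* A row beyond the end of [s] is the default empty list, which reads as 0 on both sides. *)
  have [i's|si'] := ltnP i' (size s).
    by rewrite (nth_map [::]) // nth_cat size_nseq ltn_ord nth_nseq ltn_ord.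
  by rewrite (nth_default [::]) ?size_map ?nth_nil.
rewrite block_mxEdr mxE.
have [i's|si'] := ltnP i' (size s).
  by rewrite (nth_map [::]) // nth_cat size_nseq ltnNge leq_addr addKn.
by rewrite !(nth_default [::]) ?size_map // !nth_nil.
Qed.

Variables (p : nat).

Lemma sigmaXXVI_dsum :
  sigmaXXVI k ≡ sigma1 k ⊕ sigma1 k ⊕ sigma1 k ⊕ sigma1 k.
Proof.
move=> g _; rewrite /hom_dsum !block_mx_of_rows //=.
by apply/matrixP=> i j; rewrite !mxE; case_ordinal i; case_ordinal j.
Qed.

Lemma sigmaXXIV_dsum e :
  sigmaXXIV k p e ≡ sigma21 k p e ⊕ sigma1 k ⊕ sigma1 k.
Proof. by move=> g _; rewrite /hom_dsum !block_mx_of_rows. Qed.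

Lemma sigmaXV_dsum e2 e3 :
  sigmaXV k p e2 e3 ≡ sigma21 k p e2 ⊕ sigma21 k p e3.
Proof. by move=> g _; rewrite /hom_dsum !block_mx_of_rows. Qed.

(** With the literal 2 for [p], the exponents [p * q] and [2 * q] coincide. *)
Lemma sigmaXI_dsum e : sigmaXI k 2 e ≡ sigma31b k 2 e ⊕ sigma1 k.
Proof. by move=> g _; rewrite /hom_dsum !block_mx_of_rows. Qed.

Lemma sigmaXIX_dsum e : sigmaXIX k 2 e ≡ sigma31a k 2 e ⊕ sigma1 k.
Proof. by move=> g _; rewrite /hom_dsum !block_mx_of_rows. Qed.

Lemma sigmaIX_dsum e : sigmaIX k p e ≡ sigma32a k p e ⊕ sigma1 k.
Proof. by move=> g _; rewrite /hom_dsum !block_mx_of_rows. Qed.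

End DirectSums.

(** * Assembly by characteristic *)

Theorem theorem7p4 (k : closedFieldType) (p : nat) (hp : p \in [pchar k]) :
  (p = 2%N ->
    (forall e1 e2 : nat, (e1 < e2)%N -> indecomposable (sigmaIV k p e1 e2)) /\
    (forall e1 : nat, indecomposable (sigmaV k p e1)) /\
    (forall e1 : nat,
      [/\ sigmaXI k p e1 ≡ sigma31b k p e1 ⊕ sigma1 k,
          indecomposable (sigma31b k p e1) & indecomposable (sigma1 k)]) /\
    (forall e2 e3 : nat, (e3 <= e2)%N ->
      [/\ sigmaXV k p e2 e3 ≡ sigma21 k p e2 ⊕ sigma21 k p e3,
          indecomposable (sigma21 k p e2) & indecomposable (sigma21 k p e3)]) /\
    (forall e1 : nat,
      [/\ sigmaXIX k p e1 ≡ sigma31a k p e1 ⊕ sigma1 k,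
          indecomposable (sigma31a k p e1) & indecomposable (sigma1 k)]) /\
    (forall e2 : nat,
      [/\ sigmaXXIV k p e2 ≡ sigma21 k p e2 ⊕ sigma1 k ⊕ sigma1 k,
          indecomposable (sigma21 k p e2) & indecomposable (sigma1 k)]) /\
    (sigmaXXVI k ≡ sigma1 k ⊕ sigma1 k ⊕ sigma1 k ⊕ sigma1 k /\
      indecomposable (sigma1 k))) /\
  (p = 3%N ->
    (forall e1 : nat, indecomposable (sigmaII k p e1)) /\
    (forall e1 e2 : nat, (e1 < e2)%N -> indecomposable (sigmaIV k p e1 e2)) /\
    (forall e1 : nat, indecomposable (sigmaVII k p e1)) /\
    (forall e1 : nat,
      [/\ sigmaIX k p e1 ≡ sigma32a k p e1 ⊕ sigma1 k,
          indecomposable (sigma32a k p e1) & indecomposable (sigma1 k)]) /\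
    (forall e2 e3 : nat, (e3 <= e2)%N ->
      [/\ sigmaXV k p e2 e3 ≡ sigma21 k p e2 ⊕ sigma21 k p e3,
          indecomposable (sigma21 k p e2) & indecomposable (sigma21 k p e3)]) /\
    (forall e2 : nat,
      [/\ sigmaXXIV k p e2 ≡ sigma21 k p e2 ⊕ sigma1 k ⊕ sigma1 k,
          indecomposable (sigma21 k p e2) & indecomposable (sigma1 k)]) /\
    (sigmaXXVI k ≡ sigma1 k ⊕ sigma1 k ⊕ sigma1 k ⊕ sigma1 k /\
      indecomposable (sigma1 k))) /\
  ((5 <= p)%N ->
    (forall e1 : nat, indecomposable (sigmaI k p e1)) /\
    (forall e1 e2 : nat, (e1 < e2)%N -> indecomposable (sigmaIV k p e1 e2)) /\
    (forall e1 : nat,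
      [/\ sigmaIX k p e1 ≡ sigma32a k p e1 ⊕ sigma1 k,
          indecomposable (sigma32a k p e1) & indecomposable (sigma1 k)]) /\
    (forall e2 e3 : nat, (e3 <= e2)%N ->
      [/\ sigmaXV k p e2 e3 ≡ sigma21 k p e2 ⊕ sigma21 k p e3,
          indecomposable (sigma21 k p e2) & indecomposable (sigma21 k p e3)]) /\
    (forall e2 : nat,
      [/\ sigmaXXIV k p e2 ≡ sigma21 k p e2 ⊕ sigma1 k ⊕ sigma1 k,
          indecomposable (sigma21 k p e2) & indecomposable (sigma1 k)]) /\
    (sigmaXXVI k ≡ sigma1 k ⊕ sigma1 k ⊕ sigma1 k ⊕ sigma1 k /\
      indecomposable (sigma1 k))).
Proof.
have sigma1P := indecomposable_sigma1 k.
have sigma21P := indecomposable_sigma21 hp.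
have sigma32aP := indecomposable_sigma32a hp.
have sigmaIVP := indecomposable_sigmaIV hp.
have XV_P e2 e3 : (e3 <= e2)%N ->
    [/\ sigmaXV k p e2 e3 ≡ sigma21 k p e2 ⊕ sigma21 k p e3,
        indecomposable (sigma21 k p e2) & indecomposable (sigma21 k p e3)].
  by split=> //; exact: sigmaXV_dsum.
have XXIV_P e2 :
    [/\ sigmaXXIV k p e2 ≡ sigma21 k p e2 ⊕ sigma1 k ⊕ sigma1 k,
        indecomposable (sigma21 k p e2) & indecomposable (sigma1 k)].
  by split=> //; exact: sigmaXXIV_dsum.
have XXVI_P : sigmaXXVI k ≡ sigma1 k ⊕ sigma1 k ⊕ sigma1 k ⊕ sigma1 k /\
    indecomposable (sigma1 k).
  by split=> //; exact: sigmaXXVI_dsum.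
have IX_P e1 :
    [/\ sigmaIX k p e1 ≡ sigma32a k p e1 ⊕ sigma1 k,
        indecomposable (sigma32a k p e1) & indecomposable (sigma1 k)].
  by split=> //; exact: sigmaIX_dsum.
split=> [p2|]; last split=> [p3|_].
- subst p; split=> //; split; first exact: indecomposable_sigmaV.
  split.
    move=> e; split=> //; first exact: sigmaXI_dsum.
    exact: indecomposable_sigma31b.
  split=> //; split=> //.
  by move=> e; split; [exact: sigmaXIX_dsum | exact: indecomposable_sigma31a |].
- subst p; split; first exact: indecomposable_sigmaII.
  by split=> //; split; first exact: indecomposable_sigmaVII.
- by split; first exact: indecomposable_sigmaI.
Qed.
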